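(* Let $X$ be a real locally convex Hausdorff topological vector space with topological dual $Y=X^\prime$, and let $C\subseteq X$ be a pointed cone. Then $C$ is represented by the family $\mathscr{K}(C)=\{G_x : x\in X\setminus C\}$, where $G_x:=\{y\in Y:\langle x,y\rangle<0\}$ for $x \in X$.
   Context: Write $\langle x,y\rangle:=y(x)$ for $x\in X$, $y\in Y=X^\prime$. A nonempty subset $C\subseteq X$ is a cone if $\lambda C\subseteq C$ for all real $\lambda>0$; it is pointed if $0\in C$. Given a nonempty family $\mathscr{K}\subseteq\mathcal{P}(Y)$ of nonempty sets, a cone $C\subseteq X$ is said to be represented by $\mathscr{K}$ if $C=C_{\mathscr{K}}$, where $$C_{\mathscr{K}}:=\{x\in X:\ \forall K\in\mathscr{K},\ \exists y\in K,\ \langle x,y\rangle\ge 0\}.$$ Convention for the degenerate case $C=X$: the family $\mathscr{K}(X)$ is understood to be $\{\emptyset\}$, and $X$ is by convention represented by $\{\emptyset\}$. *)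

(* Defs.v *)
From HB Require Import structures.
From mathcomp Require Import all_boot all_order all_algebra.
From mathcomp Require Import boolp classical_sets functions reals topology normedtype.

Set Implicit Arguments.
Unset Strict Implicit.
Unset Printing Implicit Defensive.

Import Order.TTheory GRing.Theory Num.Theory.
Import numFieldNormedType.Exports.

Local Open Scope classical_set_scope.
Local Open Scope ring_scope.

(* [tvsType R] already includes local convexity, but not the Hausdorff
   property. *)
Record dual (R : realType) (X : tvsType R) := Dual {
  dual_fun : {scalar X};
  dual_continuous : continuous (dual_fun : X -> R)
}.

Section Cones.
Context {R : realType} {X : tvsType R}.

Definition pairing (x : X) (y : dual X) : R := dual_fun y x.

Definition is_cone (C : set X) : Prop :=
  C !=set0 /\ forall l : R, 0 < l -> [set l *: x | x in C] `<=` C.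

Definition is_pointed_cone (C : set X) : Prop := is_cone C /\ C 0.

Definition cone_of (K : set (set (dual X))) : set X :=
  [set x | forall A, K A -> exists2 y, A y & 0 <= pairing x y].

(* The first disjunct is the convention for [C = X]: the whole space counts as
   represented by the family whose only member is the empty set, although
   [cone_of [set set0]] is empty. *)
Definition represented_by (C : set X) (K : set (set (dual X))) : Prop :=
  (C = setT /\ K = [set set0]) \/
  [/\ K !=set0, (forall A, K A -> A !=set0) & C = cone_of K].

Definition neg_dual (x : X) : set (dual X) := [set y | pairing x y < 0].

(* For [C = X] the family of all [neg_dual x] with [x] outside [C] would be
   empty; the convention replaces it by [{set0}]. *)
Definition complement_family (C : set X) : set (set (dual X)) :=
  if `[< C = setT >] then [set set0] else [set neg_dual x | x in ~` C].

End Cones.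

(* Main.v *)
Require Import Defs.
From HB Require Import structures.
From mathcomp Require Import all_boot all_order all_algebra.
From mathcomp Require Import boolp classical_sets functions reals topology normedtype.
From mathcomp Require Import interval_inference convex.
From mathcomp Require Import ring lra.

(** A point outside [C] cannot lie in the cone of the family: its own
    [neg_dual x] is a member of the family on which it is nowhere nonnegative.
    Conversely, given [x] in [C] and [z] outside [C], a continuous functional [y]
    is needed with [y z < 0 <= y x]. Start from a functional [f] with [f z < 0],
    which exists since [z] is nonzero. If [f x < 0], then [f] vanishes on
    [w = x - c *: z] with [c = f x / f z > 0], and [w] is nonzero: otherwise [z]
    would be a positive multiple of [x], hence in the cone. A functional [g]
    with [g w > 0] can be corrected by a multiple of [f], which leaves the value
    at [w] unchanged, so as to make the value at [z] equal to [- g w / c]; the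
    corrected functional vanishes at [x].

    What remains is that continuous functionals separate nonzero vectors from
    the origin ([dual_gt0]). A given [w != 0] is avoided by a convex open
    neighbourhood [U] of the origin, whose gauge is sublinear, at most [1] on [U]
    and at least [1] at [w]. By [hahn_banach] some linear functional is below
    the gauge everywhere and equal to it at [w]; being bounded above on [U], it
    is continuous.

    The Hahn-Banach theorem is obtained from minimal sublinear functionals, which
    exist by Zorn's lemma and are linear. The construction [directional_inf q w],
    which pushes [q] down in the direction [- w], serves twice: applied to a
    minimal [q] it shows that [q] is odd, hence linear; applied to the given [p]
    before minimizing, it forces the value at [w] to be at least [p w]. *)

Set Implicit Arguments.
Unset Strict Implicit.
Unset Printing Implicit Defensive.

Import Order.TTheory GRing.Theory Num.Theory.
Import numFieldNormedType.Exports.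

Local Open Scope classical_set_scope.
Local Open Scope ring_scope.

(** * Sublinear functionals *)

Section Sublinear.
Context {R : realType} {X : lmodType R}.
Implicit Types (p q : X -> R) (x y w : X).

Definition sublinear q :=
  (forall x y, q (x + y) <= q x + q y) /\
  (forall t x, 0 < t -> q (t *: x) <= t * q x).

(** Subhomogeneity under positive scalars is already homogeneity, since it also
    applies to the inverse scalar. *)
Lemma sublinearZ q t x : sublinear q -> 0 <= t -> q (t *: x) = t * q x.
Proof.
move=> [qD qZ].
have pos s y : 0 < s -> q (s *: y) = s * q y.
  move=> s0; apply/eqP; rewrite eq_le qZ//=.
  have := qZ s^-1 (s *: y); rewrite invr_gt0 s0 => /(_ isT).
  by rewrite scalerA mulVf ?gt_eqF// scale1r ler_pdivlMl.
rewrite le_eqVlt => /predU1P[<-|]; last exact: pos.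
have := pos 2 0 (ltr0n _ 2); rewrite scaler0 scale0r mul0r; lra.
Qed.

Lemma sublinear0 q : sublinear q -> q 0 = 0.
Proof. by move=> qs; rewrite -(scale0r 0) sublinearZ// mul0r. Qed.

Lemma sublinear_geN q x : sublinear q -> - q (- x) <= q x.
Proof.
move=> qs; have := qs.1 x (- x); rewrite subrr sublinear0//; lra.
Qed.

(** Gauges, directional infima and infima of chains are all infima over fibres
    [S x] for which the union of the [S x] is, up to decreasing the second
    coordinate, a convex cone in [X * R]. *)
Lemma sublinear_inf (S : X -> set R) :
  (forall x, S x !=set0) -> (forall x, has_lbound (S x)) ->
  (forall x y s t, S x s -> S y t -> exists2 u, S (x + y) u & u <= s + t) ->
  (forall x s t, S x s -> 0 < t -> exists2 u, S (t *: x) u & u <= t * s) ->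
  sublinear (fun x => inf (S x)).
Proof.
move=> S0 Sb SD SZ; split=> [x y|t x t0].
  rewrite -lerBlDr; apply: lb_le_inf => // s Ss.
  rewrite lerBlDl -lerBlDr; apply: lb_le_inf => // t St.
  have [u Su ust] := SD _ _ _ _ Ss St.
  by rewrite lerBlDl (le_trans _ ust)// ge_inf.
rewrite -ler_pdivrMl//; apply: lb_le_inf => // s Ss.
have [u Su us] := SZ _ _ _ Ss t0.
by rewrite ler_pdivrMl// (le_trans _ us)// ge_inf.
Qed.

(** For sublinear [q], this is the largest sublinear functional below [q] whose
    value at [- w] is at most [- q w]. *)
Definition directional_inf q w x :=
  inf [set q (x + t *: w) - t * q w | t in [set t | 0 <= t]].

Section Directional.
Context (q : X -> R) (w : X) (qs : sublinear q).

Let lower_bound x :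
  has_lbound [set q (x + t *: w) - t * q w | t in [set t | 0 <= t]].
Proof.
exists (- q (- x)) => _ [t /= t0 <-].
have := qs.1 (x + t *: w) (- x); rewrite addrAC subrr add0r sublinearZ//; lra.
Qed.

Lemma directional_inf_sublinear : sublinear (directional_inf q w).
Proof.
apply: sublinear_inf => //.
- by move=> x; exists (q (x + 0 *: w) - 0 * q w), 0 => /=.
- move=> x y _ _ [s /= s0 <-] [t /= t0 <-].
  exists (q (x + y + (s + t) *: w) - (s + t) * q w).
    by exists (s + t) => //=; rewrite addr_ge0.
  by have := qs.1 (x + s *: w) (y + t *: w); rewrite scalerDl addrACA; lra.
- move=> x _ t [s /= s0 <-] t0.
  exists (q (t *: x + (t * s) *: w) - t * s * q w).
    by exists (t * s) => //=; rewrite mulr_ge0// ltW.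
  by rewrite -scalerA -scalerDr sublinearZ ?(ltW t0)// mulrBr mulrA.
Qed.

Lemma directional_inf_le x : directional_inf q w x <= q x.
Proof.
by apply: ge_inf => //; exists 0; rewrite //= scale0r addr0 mul0r subr0.
Qed.

Lemma directional_infN : directional_inf q w (- w) <= - q w.
Proof.
apply: ge_inf => //; exists 1; first exact: ler01.
by rewrite scale1r addNr sublinear0// mul1r sub0r.
Qed.

End Directional.

(** A chain of sublinear functionals below [p] has a finite pointwise infimum,
    because each [a] in it satisfies [a x >= - a (- x) >= - p (- x)]; the
    infimum is subadditive because any two members of the chain are comparable. *)
Lemma exists_minimal_sublinear p : sublinear p ->
  exists q, [/\ sublinear q, (forall x, q x <= p x) &
    forall r, sublinear r -> (forall x, r x <= q x) -> forall x, q x <= r x].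
Proof.
move=> ps.
pose T := {q : X -> R | sublinear q /\ forall x, q x <= p x}.
pose mk q (qs : sublinear q) qp : T := exist _ q (conj qs qp).
pose le (a b : T) := `[< forall x, sval b x <= sval a x >].
have [| | |[q [qs qp]] qmin] := @ZL_preorder T (mk p ps (fun=> lexx _)) le.
- by move=> a; apply/asboolP => x.
- move=> b a c /asboolP ab /asboolP bc; apply/asboolP => x.
  exact: le_trans (bc x) (ab x).
- move=> A Atot; have [[a0 Aa0]|A0] := pselect (A !=set0); last first.
    exists (mk p ps (fun=> lexx _)) => a Aa.
    by case: A0; exists a.
  pose S x := [set sval a x | a in A].
  have Sb x : has_lbound (S x).
    exists (- p (- x)) => _ [[a [as_ ap]] _ <-] /=.
    by rewrite (le_trans _ (sublinear_geN x as_))// lerN2.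
  have S_s : sublinear (fun x => inf (S x)).
    apply: sublinear_inf => //.
    + by move=> x; exists (sval a0 x), a0.
    + move=> x y _ _ [a Aa <-] [b Ab <-].
      have [/asboolP ab|/asboolP ba] := Atot a b Aa Ab.
        exists (sval b (x + y)); first by exists b.
        have := (svalP b).1.1 x y; have := ab x; lra.
      exists (sval a (x + y)); first by exists a.
      have := (svalP a).1.1 x y; have := ba y; lra.
    + move=> x _ t [a Aa <-] t0; exists (sval a (t *: x)); first by exists a.
      exact: (svalP a).1.2.
  have S_p x : inf (S x) <= p x.
    by apply: le_trans ((svalP a0).2 x); apply: ge_inf => //; exists a0.
  exists (mk _ S_s S_p) => a Aa; apply/asboolP => x /=.
  by apply: ge_inf => //; exists a.
exists q; split=> // r rs rq x.
have rp y : r y <= p y by exact: le_trans (rq y) (qp y).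
have /asboolP := qmin (mk r rs rp) (introT (asboolP _) rq).
exact.
Qed.

(** A minimal [q] coincides with every [directional_inf q x], so that
    [q (- x) <= - q x]; an odd sublinear functional is linear. Minimizing below
    [directional_inf p w] gives [q (- w) <= - p w], that is [p w <= q w]. *)
Lemma hahn_banach p w : sublinear p ->
  exists f : {scalar X}, (forall x, f x <= p x) /\ p w <= f w.
Proof.
move=> ps.
have [q [qs qp qmin]] :=
  exists_minimal_sublinear (directional_inf_sublinear w ps).
have qN x : q (- x) = - q x.
  apply/eqP; rewrite eq_le; apply/andP; split.
    apply: le_trans (directional_infN x qs); apply: qmin.
      exact: directional_inf_sublinear.
    exact: directional_inf_le.
  by rewrite lerNl sublinear_geN.
have qD x y : q (x + y) = q x + q y.
  apply/eqP; rewrite eq_le qs.1/=.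
  have := qs.1 (x + y) (- y); rewrite addrK qN; lra.
have qZ a x : q (a *: x) = a * q x.
  have [a0|/ltW a0] := leP 0 a; first exact: sublinearZ.
  rewrite -(opprK a) scaleNr qN sublinearZ ?oppr_ge0//; ring.
have qlin : linear_for *%R q by move=> a x y; rewrite qD qZ.
pose f : {scalar X} := HB.pack q (GRing.isLinear.Build _ _ _ _ q qlin).
exists f; split=> [x|] /=.
  exact: le_trans (qp x) (directional_inf_le w ps x).
have := le_trans (qp (- w)) (directional_infN w ps).
by rewrite qN lerN2.
Qed.

End Sublinear.

(** * The gauge of a convex neighbourhood of the origin *)

Section Gauge.
Context {R : realType} {X : tvsType R}.
Implicit Types (U : set X).

Lemma convex_setP U (x y : X) (t : R) : convex_set U -> U x -> U y ->
  0 <= t -> t <= 1 -> U (t *: x + (1 - t) *: y).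
Proof.
move=> Uc Ux Uy t0 t1.
by have := Uc x y (Itv01 t0 t1) (mem_set Ux) (mem_set Uy); rewrite inE.
Qed.

Definition gauge U (x : X) := inf [set t | 0 < t /\ U (t^-1 *: x)].

Let gauge_lbound U x : has_lbound [set t : R | 0 < t /\ U (t^-1 *: x)].
Proof. by exists 0 => t [/ltW]. Qed.

Lemma gauge_le1 U x : U x -> gauge U x <= 1.
Proof. by move=> Ux; apply: ge_inf => //; rewrite /= invr1 scale1r. Qed.

(** Scalar multiplication is continuous at [(0, x)], so small multiples of [x]
    fall into any neighbourhood of the origin. *)
Lemma nbhs0_absorbing U x : nbhs 0 U -> exists2 t : R, 0 < t & U (t^-1 *: x).
Proof.
move=> U0.
have := @scale_continuous R X (0, x) U; rewrite /= scale0r => /(_ U0).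
move=> [[A B] /= [/nbhs_ballP[e /= e0 eA] Bx] ABU].
exists (e / 2)^-1; first by rewrite invr_gt0 divr_gt0.
rewrite invrK; apply: (ABU (_, _)); split=> /=; last exact: nbhs_singleton.
apply: eA.
by rewrite -ball_normE /= sub0r normrN gtr0_norm ?divr_gt0//
  ltr_pdivrMr// ltr_pMr// ltr1n.
Qed.

(** If [x] is in [s U] and [y] in [t U], then [(s + t)^-1 *: (x + y)] is the
    convex combination of [s^-1 *: x] and [t^-1 *: y] with weights proportional
    to [s] and [t]. *)
Lemma gauge_sublinear U : nbhs 0 U -> convex_set U -> sublinear (gauge U).
Proof.
move=> U0 Uc; apply: sublinear_inf => //.
- by move=> x; have [t t0 Ut] := nbhs0_absorbing x U0; exists t.
- move=> x y s t [s0 Us] [t0 Ut]; exists (s + t) => //.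
  have st0 : 0 < s + t by rewrite addr_gt0.
  split=> //.
  have -> : (s + t)^-1 *: (x + y) =
      (s / (s + t)) *: (s^-1 *: x) + (1 - s / (s + t)) *: (t^-1 *: y).
    rewrite !scalerA scalerDr; congr (_ *: _ + _ *: _); field;
      by rewrite ?gt_eqF.
  apply: convex_setP => //; first by rewrite divr_ge0// ltW.
  by rewrite ler_pdivrMr// mul1r lerDl ltW.
- move=> x s t [s0 Us] t0; exists (t * s) => //.
  split; first by rewrite mulr_gt0.
  by rewrite scalerA invfM mulrAC mulVf ?gt_eqF// mul1r.
Qed.

(** If [x] were in [t U] with [t < 1], it would be a convex combination of the
    origin and a point of [U]. *)
Lemma gauge_ge1 U x : nbhs 0 U -> convex_set U -> ~ U x -> 1 <= gauge U x.
Proof.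
move=> U0 Uc Ux; apply: lb_le_inf.
  by have [t t0 Ut] := nbhs0_absorbing x U0; exists t.
move=> t [t0 Ut]; rewrite leNgt; apply/negP => t1; apply: Ux.
have := convex_setP Uc Ut (nbhs_singleton U0) (ltW t0) (ltW t1).
by rewrite scaler0 addr0 scalerA divff ?gt_eqF// scale1r.
Qed.

(** A one-sided bound suffices: on the intersection of [U] and its opposite it
    becomes a bound on the absolute value, and scaling that intersection by [e]
    bounds the variation of [f] by [e]. *)
Lemma scalar_continuous (f : {scalar X}) U :
  nbhs 0 U -> (forall x, U x -> f x <= 1) -> continuous (f : X -> R).
Proof.
move=> U0 fU x; apply/cvgrPdist_le => e e0.
have V0 : nbhs 0 (U `&` -%R @` U) by apply: filterI => //; exact: nbhs0N.
have := nbhsT x (nbhs0Z (lt0r_neq0 e0) V0).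
apply: filterS => _ [_ [v [Uv [u Uu uv]] <-] <-].
rewrite raddfD opprD addNKr normrN.
suff fev : `|e * f v| <= e by rewrite -scalarZ in fev.
rewrite normrM gtr0_norm//.
rewrite ler_piMr ?(ltW e0)// ler_norml fU// andbT.
by rewrite -uv raddfN lerN2 fU.
Qed.

End Gauge.

(** * The dual of a Hausdorff locally convex space *)

Section Dual.
Context {R : realType} {X : tvsType R}.

Lemma dual_gt0 (w : X) : hausdorff_space X -> w != 0 ->
  exists y : dual X, 0 < pairing w y.
Proof.
move=> /hausdorff_accessible X1; rewrite eq_sym => /X1[A [Ao]].
rewrite !inE => A0 Aw.
have [B Bc [Bo Bb]] := @locally_convex R X.
have [U [BU U0] UA] := Bb 0 A (open_nbhs_nbhs (conj Ao A0)).
have Uo : open U by exact: Bo.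
have {}Uc : convex_set U by apply: Bc; rewrite inE.
have Un : nbhs (0 : X) U by exact: open_nbhs_nbhs.
have Uw : ~ U w by move=> /UA.
have [f [fg gf]] := hahn_banach w (gauge_sublinear Un Uc).
have fc : continuous (f : X -> R).
  by apply: (scalar_continuous Un) => x Ux;
    rewrite (le_trans (fg x))// gauge_le1.
exists (Dual fc); rewrite /pairing /=.
by apply: lt_le_trans gf; rewrite (lt_le_trans ltr01)// gauge_ge1.
Qed.

Lemma pairingP (a : R) (x z : X) (y : dual X) :
  pairing (a *: x + z) y = a * pairing x y + pairing z y.
Proof. by rewrite /pairing raddfD; congr (_ + _); exact: scalarZ. Qed.

Lemma dual_combination (a : R) (f g : dual X) :
  exists h : dual X, forall x, pairing x h = a * pairing x f + pairing x g.
Proof.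
pose h x := a * pairing x f + pairing x g.
have hlin : linear_for *%R h.
  by move=> b x y; rewrite /h !pairingP; ring.
pose h' : {scalar X} := HB.pack h (GRing.isLinear.Build _ _ _ _ h hlin).
suff hc : continuous (h' : X -> R) by exists (Dual hc).
move=> x; apply: cvgD; last exact: dual_continuous.
by apply: cvgM; [exact: cvg_cst|exact: dual_continuous].
Qed.

End Dual.

Theorem theorem2p2 (R : realType) (X : tvsType R) (hX : hausdorff_space X)
    (C : set X) (hC : is_pointed_cone C) :
  represented_by C (complement_family C).
Proof.
have [[_ Cscale] C0] := hC.
have negP z : ~ C z -> exists y, neg_dual z y.
  move=> Cz; have Nz0 : - z != 0.
    by rewrite oppr_eq0; apply/eqP => z0; apply: Cz; rewrite z0.
  have [y] := dual_gt0 hX Nz0.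
  by rewrite /pairing raddfN oppr_gt0 => ?; exists y.
rewrite /complement_family; case: asboolP => [->|CT]; first by left.
right; split.
- have [z Cz] : exists z, ~ C z.
    apply: contrapT => h; apply: CT; rewrite -subTset => z _.
    by apply: contrapT => Cz; apply: h; exists z.
  by exists (neg_dual z), z.
- by move=> _ [z Cz <-]; exact: negP.
rewrite eqEsubset; split=> [x Cx _ [z Cz <-]|x Kx].
- have [f fz] := negP _ Cz.
  have [fx|fx] := leP 0 (pairing x f); first by exists f.
  pose c := pairing x f / pairing z f.
  have c0 : 0 < c by rewrite nmulr_rgt0// invr_lt0.
  pose w := x - c *: z.
  have xE : x = w + c *: z by rewrite subrK.
  have w0 : w != 0.
    apply/eqP => w0; apply: Cz; apply: (Cscale c^-1); first by rewrite invr_gt0.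
    by exists x => //; rewrite xE w0 add0r scalerA mulVf ?gt_eqF// scale1r.
  have [g gw] := dual_gt0 hX w0.
  (* The coefficient of [f] is the one that makes the value at [z] equal to
     [- pairing w g / c], and hence the value at [x = w + c *: z] zero. *)
  have [y yE] :=
    dual_combination ((- (pairing w g / c) - pairing z g) / pairing z f) f g.
  have zE : pairing z y = - (pairing w g / c).
    by rewrite yE divfK ?lt_eqF// subrK.
  have wy : pairing w y = pairing w g.
    rewrite yE {2}/w; have -> : pairing w f = 0; last by rewrite mulr0 add0r.
    by rewrite /w addrC -scaleNr pairingP mulNr divfK ?addNr// lt_eqF.
  exists y; first by rewrite /neg_dual /= zE oppr_lt0 divr_gt0.
  rewrite xE addrC pairingP wy zE mulrN mulrC divfK ?gt_eqF//.
  by rewrite addNr.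
- apply: contrapT => Cx.
  have [y /= yx0 yx] := Kx (neg_dual x) (ex_intro2 _ _ x Cx erefl).
  by move: yx; rewrite leNgt yx0.
Qed.
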